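(* Let $A\in\mathrm{End}(\mathbb C^n\otimes\mathbb C^n)$, $\widetilde A\in\mathrm{End}(\mathbb C^m\otimes\mathbb C^m)$, $\widehat A\in\mathrm{End}(\mathbb C^l\otimes\mathbb C^l)$ be idempotents and let $S_{(k)},A_{(k)}$; $\widetilde S_{(k)},\widetilde A_{(k)}$; $\widehat S_{(k)},\widehat A_{(k)}$ be the ($k$-th) pairing operators for $A$, $\widetilde A$, $\widehat A$ respectively. Let $M$ and $N$ be $n\times m$ and $m\times l$ matrices over an associative unital $\mathbb C$-algebra $\mathfrak R$ such that every entry of $M$ commutes with every entry of $N$. (1) If $N$ is an $(\widetilde A,\widehat A)$-Manin matrix, then $$\mathrm{Min}^{S_{(k)}}_{\widehat S_{(k)}}(MN)=\big(\mathrm{Min}^{S_{(k)}}_{\widetilde S_{(k)}}M\big)\big(\mathrm{Min}_{\widehat S_{(k)}}N\big).$$ (2) If $M$ is an $(A,\widetilde A)$-Manin matrix, then $$\mathrm{Min}^{A_{(k)}}_{\widehat A_{(k)}}(MN)=\big(\mathrm{Min}^{A_{(k)}}M\big)\big(\mathrm{Min}^{\widetilde A_{(k)}}_{\widehat A_{(k)}}N\big).$$ (3) If $M$ and $N$ are Manin matrices for $(A,\widetilde A)$ and $(\widetilde A,\widehat A)$ respectively, then $MN$ is an $(A,\widehat A)$-Manin matrix and $$\mathrm{Min}_{\widehat S_{(k)}}(MN)=\big(\mathrm{Min}_{\widetilde S_{(k)}}M\big)\big(\mathrm{Min}_{\widehat S_{(k)}}N\big),\qquad \mathrm{Min}^{A_{(k)}}(MN)=\big(\mathrm{Min}^{A_{(k)}}M\big)\big(\mathrm{Min}^{\widetilde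 A_{(k)}}N\big).$$
   Context: For an $n\times m$ matrix $M=(M^i_j)$ over $\mathfrak R$, $M^{(1)}\cdots M^{(k)}\in\mathfrak R\otimes\mathrm{Hom}((\mathbb C^m)^{\otimes k},(\mathbb C^n)^{\otimes k})$ has entries $M^{i_1}_{j_1}\cdots M^{i_k}_{j_k}$. For idempotents $A\in\mathrm{End}(\mathbb C^n\otimes\mathbb C^n)$, $B\in\mathrm{End}(\mathbb C^m\otimes\mathbb C^m)$, $M$ is an $(A,B)$-Manin matrix (a Manin matrix for $(A,B)$) if $AM^{(1)}M^{(2)}(1-B)=0$. Minor operators: for $T\in\mathrm{End}((\mathbb C^n)^{\otimes k})$, $\widetilde T\in\mathrm{End}((\mathbb C^m)^{\otimes k})$, $\mathrm{Min}^T_{\widetilde T}M=TM^{(1)}\cdots M^{(k)}\widetilde T$. For an $(A,\widetilde A)$-Manin matrix $M$, $\mathrm{Min}_{\widetilde S_{(k)}}M=M^{(1)}\cdots M^{(k)}\widetilde S_{(k)}$ and $\mathrm{Min}^{A_{(k)}}M=A_{(k)}M^{(1)}\cdots M^{(k)}$. Pairing operators: let $A\in\mathrm{End}(\mathbb C^n\otimes\mathbb C^n)$ be an idempotent, $S=1-A$, with entries $A(e_i\otimes e_j)=\sum A^{kl}_{ij}e_k\otimes e_l$. Four unital associative $\mathbb C$-algebras are associated to $A$: $\mathfrak X_A(\mathbb C)$, generators $x^1,\dots,x^n$, relations $\sum_{i,j}A^{kl}_{ij}x^ix^j=0$; $\mathfrak X^*_A(\mathbb C)$, generators $x_1,\dots,x_n$,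 relations $\sum_{i,j}x_ix_jA^{ij}_{kl}=0$; $\Xi_A(\mathbb C)$, generators $\psi_1,\dots,\psi_n$, relations $\psi_i\psi_j=\sum_{k,l}A^{kl}_{ij}\psi_k\psi_l$; $\Xi^*_A(\mathbb C)$, generators $\psi^1,\dots,\psi^n$, relations $\psi^i\psi^j=\sum_{k,l}A^{ij}_{kl}\psi^k\psi^l$. Put $X=\sum x^ie_i$, $X^*=\sum x_ie^i$, $\Psi=\sum\psi_ie^i$, $\Psi^*=\sum\psi^ie_i$ and (with $k$ factors) $X\otimes\cdots\otimes X=\sum x^{i_1}\cdots x^{i_k}e_{i_1}\otimes\cdots\otimes e_{i_k}$, etc. Operators act on columns from the left, on rows from the right; $T^{(a,a+1)}$ acts as $T$ in factors $a,a+1$. The $k$-th pairing operators for $A$ are $S_{(k)},A_{(k)}\in\mathrm{End}((\mathbb C^n)^{\otimes k})$ with: $A^{(a,a+1)}S_{(k)}=S_{(k)}A^{(a,a+1)}=0$ ($1\le a\le k-1$), $(X^*\otimes\cdots\otimes X^* )S_{(k)}=X^*\otimes\cdots\otimes X^*$, $S_{(k)}(X\otimes\cdots\otimes X)=X\otimes\cdots\otimes X$; and $S^{(a,a+1)}A_{(k)}=A_{(k)}S^{(a,a+1)}=0$ ($1\le a\le k-1$), $(\Psi\otimes\cdots\otimes\Psi)A_{(k)}=\Psi\otimes\cdots\otimes\Psi$, $A_{(k)}(\Psi^*\otimes\cdots\otimes\Psi^* )=\Psi^*\otimes\cdots\otimes\Psi^*$. Their existence is assumed. *)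

(* Defs.v *)
From HB Require Import structures.
From mathcomp Require Import all_boot all_order all_algebra.
From mathcomp Require Import boolp reals.
From mathcomp Require Import complex.
From mathcomp Require Import monalg.

Set Implicit Arguments.
Unset Strict Implicit.
Unset Printing Implicit Defensive.

Import GRing.Theory.

Local Open Scope ring_scope.
Local Open Scope quotient_scope.

Section PresentedAlgebra.
Variables (K : fieldType) (n : nat).

Local Notation free_alg := {malg K[{fmonom 'I_n}]}.

Definition free_gen (i : 'I_n) : free_alg := << fmu i >>.

(* The relations are required to have no constant term, so that the ideal they
   generate is proper: [algType] only contains nonzero algebras. *)
Record presentation := Presentation {
  prel_index : Type;
  prel : prel_index -> free_alg;
  prel_const0 : forall t, mcoeff mone (prel t) = 0
}.

Variable p : presentation.

(* The two-sided ideal generated by the relations. *)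
Inductive in_ideal : free_alg -> Prop :=
| in_ideal0 : in_ideal 0
| in_idealD (a b f : free_alg) (t : prel_index p) :
    in_ideal f -> in_ideal (a * prel t * b + f).

Definition pres_ideal : {pred free_alg} := fun f => `[< in_ideal f >].

Lemma pres_idealP f : reflect (in_ideal f) (f \in pres_ideal).
Proof. exact: asboolP. Qed.

Lemma pres_idealD : {in pres_ideal &, forall f g, f + g \in pres_ideal}.
Proof.
move=> f g /pres_idealP hf /pres_idealP hg; apply/pres_idealP.
elim: hf => [|a b h t _ IH]; first by rewrite add0r.
by rewrite -addrA; apply: in_idealD.
Qed.

Lemma pres_idealMl u : {in pres_ideal, forall f, u * f \in pres_ideal}.
Proof.
move=> f /pres_idealP hf; apply/pres_idealP.
elim: hf => [|a b h t _ IH]; first by rewrite mulr0; apply: in_ideal0.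
by rewrite mulrDr !mulrA; apply: in_idealD.
Qed.

Lemma pres_idealMr u : {in pres_ideal, forall f, f * u \in pres_ideal}.
Proof.
move=> f /pres_idealP hf; apply/pres_idealP.
elim: hf => [|a b h t _ IH]; first by rewrite mul0r; apply: in_ideal0.
by rewrite mulrDl -[_ * b * u]mulrA; apply: in_idealD.
Qed.

Lemma pres_ideal_zmod : zmod_closed pres_ideal.
Proof.
split=> [|f g hf hg]; first by apply/pres_idealP; apply: in_ideal0.
by rewrite pres_idealD // -mulN1r pres_idealMl.
Qed.

Lemma pres_ideal1 : 1 \notin pres_ideal.
Proof.
apply/pres_idealP => h1.
suff h0 f : in_ideal f -> mcoeff mone f = 0.
  by move/eqP: (h0 _ h1); rewrite rmorph1 oner_eq0.
elim=> [|a b g t _ IH]; first by rewrite raddf0.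
by rewrite raddfD /= IH addr0 !rmorphM /= prel_const0 mulr0 mul0r.
Qed.

HB.instance Definition _ :=
  GRing.isZmodClosed.Build free_alg pres_ideal pres_ideal_zmod.

(* The algebra with generators ['I_n] and relations [prel p].  The additive
   quotient is MathComp's; MathComp has no ring structure on the quotient of a
   noncommutative ring, so it is added here. *)
Definition pres_alg := Quotient.quot pres_ideal.
HB.instance Definition _ := GRing.Zmodule.on pres_alg.
HB.instance Definition _ := EqQuotient.on pres_alg.

Local Notation pi := (\pi_pres_alg).

Lemma pres_piE f g : (pi f = pi g) <-> (f - g \in pres_ideal).
Proof.
split=> [/eqP|h]; first by rewrite -(Quotient.idealrBE pres_ideal).
by apply/eqP; rewrite -(Quotient.idealrBE pres_ideal).
Qed.

Lemma pres_piD f g : pi (f + g) = pi f + pi g.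
Proof. exact: (Quotient.pi_add pres_ideal). Qed.

Lemma pres_reprK f : f - repr (pi f) \in pres_ideal.
Proof. by apply/pres_piE; rewrite reprK. Qed.

Definition pres_one : pres_alg := pi 1.
Definition pres_mul (x y : pres_alg) : pres_alg := pi (repr x * repr y).
Definition pres_scale (c : K) (x : pres_alg) : pres_alg := pi (c *: repr x).

Lemma pres_piM f g : pi (f * g) = pres_mul (pi f) (pi g).
Proof.
apply/pres_piE; set f' := repr (pi f); set g' := repr (pi g).
have -> : f * g - f' * g' = (f - f') * g + f' * (g - g').
  by rewrite mulrBl mulrBr addrA subrK.
by apply: pres_idealD; [apply: pres_idealMr | apply: pres_idealMl];
  apply: pres_reprK.
Qed.

Lemma pres_piZ c f : pi (c *: f) = pres_scale c (pi f).
Proof.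
by apply/pres_piE; rewrite -scalerBr -mul_malgC pres_idealMl // pres_reprK.
Qed.

Lemma pres_mulA : associative pres_mul.
Proof.
elim/quotW=> f; elim/quotW=> g; elim/quotW=> h.
by rewrite -(pres_piM g h) -(pres_piM f g) -!pres_piM mulrA.
Qed.

Lemma pres_mul1 : left_id pres_one pres_mul.
Proof. by elim/quotW=> f; rewrite -(pres_piM 1 f) mul1r. Qed.

Lemma pres_mulr1 : right_id pres_one pres_mul.
Proof. by elim/quotW=> f; rewrite -(pres_piM f 1) mulr1. Qed.

Lemma pres_mulDl : left_distributive pres_mul +%R.
Proof.
elim/quotW=> f; elim/quotW=> g; elim/quotW=> h.
by rewrite -pres_piD -(pres_piM f h) -(pres_piM g h) -pres_piM -pres_piD mulrDl.
Qed.

Lemma pres_mulDr : right_distributive pres_mul +%R.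
Proof.
elim/quotW=> f; elim/quotW=> g; elim/quotW=> h.
by rewrite -pres_piD -(pres_piM f h) -(pres_piM f g) -pres_piM -pres_piD mulrDr.
Qed.

Lemma pres_one_neq0 : pres_one != 0.
Proof.
apply/negP => /eqP h; have /pres_piE : pi 1 = pi 0.
  by rewrite -[pi 1]/pres_one h; apply: (addrI (pi 0)); rewrite addr0 -pres_piD addr0.
by rewrite subr0; apply/negP/pres_ideal1.
Qed.

HB.instance Definition _ := GRing.Zmodule_isNzRing.Build pres_alg
  pres_mulA pres_mul1 pres_mulr1 pres_mulDl pres_mulDr pres_one_neq0.

Lemma pres_scaleA a b x :
  pres_scale a (pres_scale b x) = pres_scale (a * b) x.
Proof. by elim/quotW: x => f; rewrite -(pres_piZ b f) -!pres_piZ scalerA. Qed.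

Lemma pres_scale1 : left_id 1 pres_scale.
Proof. by elim/quotW=> f; rewrite -(pres_piZ 1 f) scale1r. Qed.

Lemma pres_scaleDr : right_distributive pres_scale +%R.
Proof.
move=> c; elim/quotW=> f; elim/quotW=> g.
by rewrite -pres_piD -(pres_piZ c f) -(pres_piZ c g) -pres_piZ -pres_piD scalerDr.
Qed.

Lemma pres_scaleDl x : {morph pres_scale^~ x : a b / a + b}.
Proof.
elim/quotW: x => f a b.
by rewrite -(pres_piZ a f) -(pres_piZ b f) -(pres_piZ _ f) -pres_piD scalerDl.
Qed.

HB.instance Definition _ := GRing.Zmodule_isLmodule.Build K pres_alg
  pres_scaleA pres_scale1 pres_scaleDr pres_scaleDl.

Lemma pres_scaleAl (c : K) (x y : pres_alg) : c *: (x * y) = (c *: x) * y.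
Proof.
elim/quotW: x => f; elim/quotW: y => g.
rewrite -[LHS]/(pres_scale c (pres_mul (pi f) (pi g))).
rewrite -[RHS]/(pres_mul (pres_scale c (pi f)) (pi g)).
by rewrite -(pres_piM f g) -(pres_piZ c f) -pres_piM -pres_piZ scalerAl.
Qed.

HB.instance Definition _ := GRing.Lmodule_isLalgebra.Build K pres_alg pres_scaleAl.

Lemma malg_scaleAr (c : K) (f g : free_alg) : c *: (f * g) = f * (c *: g).
Proof.
rewrite -!mul_malgC mulrA [RHS]mulrA; congr (_ * g).
rewrite [f]monalgE mulr_sumr mulr_suml; apply: eq_bigr => k _.
by rewrite !malgM_def !fgmulUU mul1m mulm1 mulrC.
Qed.

Lemma pres_scaleAr (c : K) (x y : pres_alg) : c *: (x * y) = x * (c *: y).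
Proof.
elim/quotW: x => f; elim/quotW: y => g.
rewrite -[LHS]/(pres_scale c (pres_mul (pi f) (pi g))).
rewrite -[RHS]/(pres_mul (pi f) (pres_scale c (pi g))).
by rewrite -(pres_piM f g) -(pres_piZ c g) -pres_piM -pres_piZ malg_scaleAr.
Qed.

HB.instance Definition _ := GRing.Lalgebra_isAlgebra.Build K pres_alg pres_scaleAr.

Definition pres_gen (i : 'I_n) : pres_alg := pi (free_gen i).

End PresentedAlgebra.

Section TensorPowers.

Definition tdim (n k : nat) := #|{: k.-tuple 'I_n}|.

(* Elements of [Hom((C^m)^{(x)k}, (C^n)^{(x)k})], with coefficients in [R], are
   matrices whose rows and columns are numbered by multi-indices. *)
Definition tmx (R : Type) (n m k : nat)
    (f : k.-tuple 'I_n -> k.-tuple 'I_m -> R) : 'M[R]_(tdim n k, tdim m k) :=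
  \matrix_(i, j) f (enum_val i) (enum_val j).

Definition tentry (R : Type) (n m k : nat) (T : 'M[R]_(tdim n k, tdim m k))
    (I : k.-tuple 'I_n) (J : k.-tuple 'I_m) : R :=
  T (enum_rank I) (enum_rank J).

(* [coef2 A k l i j] is the entry A^{kl}_{ij}. *)
Definition coef2 (R : Type) (n : nat) (A : 'M[R]_(tdim n 2)) (k l i j : 'I_n) : R :=
  tentry A [tuple k; l] [tuple i; j].

(* [act_on a b T] acts as [T] in the tensor factors [a] and [b]. *)
Definition act_on (R : nmodType) (n k : nat) (a b : 'I_k) (T : 'M[R]_(tdim n 2)) :
    'M[R]_(tdim n k) :=
  tmx (fun I J =>
    coef2 T (tnth I a) (tnth I b) (tnth J a) (tnth J b)
      *+ [forall c, (c != a) && (c != b) ==> (tnth I c == tnth J c)]).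

Definition mxpow (R : pzRingType) (n m k : nat) (M : 'M[R]_(n, m)) :
    'M[R]_(tdim n k, tdim m k) :=
  tmx (fun I J => \prod_(a < k) M (tnth I a) (tnth J a)).

Definition colpow (R : pzRingType) (n k : nat) (x : 'I_n -> R) : 'cV[R]_(tdim n k) :=
  \col_i \prod_(a < k) x (tnth (enum_val i) a).

Definition rowpow (R : pzRingType) (n k : nat) (x : 'I_n -> R) : 'rV[R]_(tdim n k) :=
  \row_i \prod_(a < k) x (tnth (enum_val i) a).

(* [T] viewed as [1 (x) T], i.e. with coefficients in the algebra [R]. *)
Definition scal_mx (K : fieldType) (R : algType K) (p q : nat) (T : 'M[K]_(p, q)) :
    'M[R]_(p, q) := map_mx (fun c => c%:A) T.

End TensorPowers.

Arguments mxpow {R n m} k M.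
Arguments colpow {R n} k x.
Arguments rowpow {R n} k x.
Arguments scal_mx {K} R {p q} T.

Section Manin.
Variables (K : fieldType) (R : algType K).

Definition idempotent_mx (p : nat) (A : 'M[K]_p) : Prop := A *m A = A.

Definition manin (n m : nat) (A : 'M[K]_(tdim n 2)) (B : 'M[K]_(tdim m 2))
    (M : 'M[R]_(n, m)) : Prop :=
  scal_mx R A *m mxpow 2 M *m scal_mx R (1%:M - B) = 0.

Definition minor (n m k : nat) (T : 'M[K]_(tdim n k)) (T' : 'M[K]_(tdim m k))
    (M : 'M[R]_(n, m)) : 'M[R]_(tdim n k, tdim m k) :=
  scal_mx R T *m mxpow k M *m scal_mx R T'.

Definition minor_lower (n m k : nat) (S : 'M[K]_(tdim m k)) (M : 'M[R]_(n, m)) :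
    'M[R]_(tdim n k, tdim m k) := mxpow k M *m scal_mx R S.

Definition minor_upper (n m k : nat) (A : 'M[K]_(tdim n k)) (M : 'M[R]_(n, m)) :
    'M[R]_(tdim n k, tdim m k) := scal_mx R A *m mxpow k M.

End Manin.

Section PairingOperators.
Variables (K : fieldType) (n : nat) (A : 'M[K]_(tdim n 2)).

(* [X], [Xs], [Xi], [Xis] stand for the four quadratic algebras of [A] written
   with the letters X, X^*, Xi (Greek) and Xi^*.  Whether a generator carries its
   index up or down only shows in which indices of [A] the relations sum over. *)
Local Notation x := (@free_gen K n).

Lemma free_gen2_const0 i j : mcoeff mone (x i * x j) = 0.
Proof.
have hx l : mcoeff mone (x l) = 0.
  rewrite /free_gen mcoeffU; case: eqP => // /(congr1 (@fmonom_val _)).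
  by rewrite fmU fm1.
by rewrite rmorphM /= !hx mulr0.
Qed.

Definition X_rel (kl : 'I_n * 'I_n) : {malg K[{fmonom 'I_n}]} :=
  \sum_i \sum_j coef2 A kl.1 kl.2 i j *: (x i * x j).

Lemma X_const0 kl : mcoeff mone (X_rel kl) = 0.
Proof.
rewrite raddf_sum big1 // => i _; rewrite raddf_sum big1 // => j _.
by rewrite /= mcoeffZ free_gen2_const0 mulr0.
Qed.

Definition X_pres := Presentation (prel := X_rel) X_const0.

Definition Xs_rel (kl : 'I_n * 'I_n) : {malg K[{fmonom 'I_n}]} :=
  \sum_i \sum_j coef2 A i j kl.1 kl.2 *: (x i * x j).

Lemma Xs_const0 kl : mcoeff mone (Xs_rel kl) = 0.
Proof.
rewrite raddf_sum big1 // => i _; rewrite raddf_sum big1 // => j _.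
by rewrite /= mcoeffZ free_gen2_const0 mulr0.
Qed.

Definition Xs_pres := Presentation (prel := Xs_rel) Xs_const0.

Definition Xi_rel (ij : 'I_n * 'I_n) : {malg K[{fmonom 'I_n}]} :=
  x ij.1 * x ij.2 - \sum_k \sum_l coef2 A k l ij.1 ij.2 *: (x k * x l).

Lemma Xi_const0 ij : mcoeff mone (Xi_rel ij) = 0.
Proof.
rewrite raddfB /= free_gen2_const0 sub0r; apply/eqP; rewrite oppr_eq0; apply/eqP.
rewrite raddf_sum big1 // => k _; rewrite raddf_sum big1 // => l _.
by rewrite /= mcoeffZ free_gen2_const0 mulr0.
Qed.

Definition Xi_pres := Presentation (prel := Xi_rel) Xi_const0.

Definition Xis_rel (ij : 'I_n * 'I_n) : {malg K[{fmonom 'I_n}]} :=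
  x ij.1 * x ij.2 - \sum_k \sum_l coef2 A ij.1 ij.2 k l *: (x k * x l).

Lemma Xis_const0 ij : mcoeff mone (Xis_rel ij) = 0.
Proof.
rewrite raddfB /= free_gen2_const0 sub0r; apply/eqP; rewrite oppr_eq0; apply/eqP.
rewrite raddf_sum big1 // => k _; rewrite raddf_sum big1 // => l _.
by rewrite /= mcoeffZ free_gen2_const0 mulr0.
Qed.

Definition Xis_pres := Presentation (prel := Xis_rel) Xis_const0.

Definition X_gen : 'I_n -> pres_alg X_pres := @pres_gen _ _ X_pres.
Definition Xs_gen : 'I_n -> pres_alg Xs_pres := @pres_gen _ _ Xs_pres.
Definition Xi_gen : 'I_n -> pres_alg Xi_pres := @pres_gen _ _ Xi_pres.
Definition Xis_gen : 'I_n -> pres_alg Xis_pres := @pres_gen _ _ Xis_pres.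

Definition S_pairing (k : nat) (S : 'M[K]_(tdim n k)) : Prop :=
  [/\ forall a b : 'I_k, b = a.+1 :> nat ->
        act_on a b A *m S = 0 /\ S *m act_on a b A = 0,
      rowpow k Xs_gen *m scal_mx (pres_alg Xs_pres) S = rowpow k Xs_gen
    & scal_mx (pres_alg X_pres) S *m colpow k X_gen = colpow k X_gen].

Definition A_pairing (k : nat) (Ak : 'M[K]_(tdim n k)) : Prop :=
  [/\ forall a b : 'I_k, b = a.+1 :> nat ->
        act_on a b (1%:M - A) *m Ak = 0 /\ Ak *m act_on a b (1%:M - A) = 0,
      rowpow k Xi_gen *m scal_mx (pres_alg Xi_pres) Ak = rowpow k Xi_gen
    & scal_mx (pres_alg Xis_pres) Ak *m colpow k Xis_gen = colpow k Xis_gen].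

Definition pairing_operators (k : nat) (S Ak : 'M[K]_(tdim n k)) : Prop :=
  S_pairing S /\ A_pairing Ak.

End PairingOperators.

(* Main.v *)
(* Since the entries of M and N commute, (MN)^(k) = M^(k) N^(k), so everything
   reduces to two absorption identities: tS N^(k) hS = N^(k) hS when N is
   (tA, hA)-Manin, and dually A_k M^(k) tA_k = A_k M^(k) when M is (A, tA)-Manin.
   The Manin relation together with hA^(a,a+1) hS = 0 shows that
   Q = N^(k) hS is killed by every tA^(a,a+1).  This says that the columns of Q
   satisfy the quadratic relations of X_(tA) placed in any two adjacent positions,
   so x^I |-> Q_I defines a linear map on the degree k part of X_(tA); applying it
   to the identity S X^k = X^k gives tS Q = Q.  The dual identity uses Xi_(tA). *)
From HB Require Import structures.
Require Import Defs.
From mathcomp Require Import all_boot all_order all_algebra.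
From mathcomp Require Import reals.
From mathcomp Require Import complex.
From mathcomp Require Import finmap monalg.

Set Implicit Arguments.
Unset Strict Implicit.
Unset Printing Implicit Defensive.

Import GRing.Theory.
Local Open Scope ring_scope.

(** * Linear maps out of the degree [k] part of a quadratic algebra *)

Section QuadraticPresentation.
Variables (K : fieldType) (n : nat) (p : presentation K n).
Variable c : prel_index p -> 'I_n -> 'I_n -> K.
Hypothesis prel_quadratic : forall t,
  prel t = \sum_i \sum_j c t i j *: (@free_gen K n i * @free_gen K n j).

Local Notation pi := (\pi_(pres_alg p)%qT).
Local Notation word s := (<< FMonom s >> : {malg K[{fmonom 'I_n}]}).

Let wordM (s t : seq 'I_n) : word s * word t = word (s ++ t).
Proof. by rewrite malgM_def fgmulUU mulr1 [mmul _ _]fmmulE. Qed.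

Let free_genE i : @free_gen K n i = word [:: i].
Proof. by rewrite /free_gen fmuE. Qed.

Let pi0 : pi 0 = 0.
Proof. by apply: (addrI (pi 0)); rewrite addr0 -pres_piD addr0. Qed.

Lemma pres_gen_prod (k : nat) (I : k.-tuple 'I_n) :
  \prod_(a < k) pres_gen p (tnth I a) = pi (word I).
Proof.
rewrite -(big_tuple _ _ I xpredT); elim: (tval I) => [|i s IH].
  by rewrite big_nil -fmoneE.
by rewrite big_cons IH -cat1s -wordM pres_piM /pres_gen free_genE.
Qed.

Variables (k : nat) (V : lmodType K) (F : seq 'I_n -> V).

(** Words of length other than [k] go to 0, so [phi] sees only the degree [k] component. [F] takes
    arbitrary sequences, so that concatenated words need no length proof. *)
Let phi (g : {malg K[{fmonom 'I_n}]}) : V :=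
  \sum_(I : k.-tuple 'I_n) g@_(FMonom I) *: F I.

Let phi_is_linear : linear phi.
Proof.
move=> a g h; rewrite /phi scaler_sumr -big_split /=; apply: eq_bigr => I _.
by rewrite mcoeffD mcoeffZ scalerDl scalerA.
Qed.

HB.instance Definition _ :=
  GRing.isLinear.Build K {malg K[{fmonom 'I_n}]} V _ phi phi_is_linear.

Let phi_word s : phi (word s) = if size s == k then F s else 0.
Proof.
rewrite /phi; case: eqP => [sk|/eqP sk].
  have sk' : size s == k by apply/eqP.
  rewrite (bigD1 (Tuple sk')) //= mcoeffUU scale1r big1 ?addr0 // => I neI.
  rewrite mcoeffU; case: eqP => [[sI]|]; last by rewrite scale0r.
  by case/eqP: neI; apply: val_inj.
rewrite big1 // => I _; rewrite mcoeffU; case: eqP => [[sI]|].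
  by rewrite sI size_tuple eqxx in sk.
by rewrite scale0r.
Qed.

Hypothesis F_rel : forall t (u w : seq 'I_n), (size u + 2 + size w)%N = k ->
  \sum_i \sum_j c t i j *: F (u ++ [:: i; j] ++ w) = 0.

Let phi_word_rel (t : prel_index p) u w : phi (word u * prel t * word w) = 0.
Proof.
rewrite prel_quadratic mulr_sumr mulr_suml linear_sum.
under eq_bigr => i _.
  rewrite mulr_sumr mulr_suml linear_sum.
  under eq_bigr => j _.
    rewrite !free_genE wordM -malg_scaleAr wordM -scalerAl wordM -catA linearZ /=.
    rewrite phi_word !size_cat /=.
    over.
  over.
(* Every word in the expansion has length [size u + 2 + size w]: if this is [k], [F_rel] applies;
   otherwise [phi] kills each term. *)
case: eqP => [uwk|_]; first by rewrite F_rel -?addnA.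
by rewrite big1 // => i _; rewrite big1 // => j _; rewrite scaler0.
Qed.

Let malg_word (g : {malg K[{fmonom 'I_n}]}) :
  g = \sum_(m <- msupp g) g@_m *: word (fmonom_val m).
Proof.
rewrite [LHS]monalgE; apply: eq_bigr => m _.
by rewrite malgZ_def /fgscale msuppU oner_eq0 big_seq_fset1 mcoeffUU mulr1 fmK.
Qed.

(** By linearity, [a] and [b] in a summand [a * prel t * b] may be taken to be words, where
    [phi_word_rel] applies. *)
Let phi_ideal g : in_ideal p g -> phi g = 0.
Proof.
elim=> [|a b f t _ IH]; first exact: linear0.
rewrite linearD [X in _ + X]IH addr0 /=.
have phi_r u : phi (word u * prel t * b) = 0.
  rewrite (malg_word b) [_ * (\sum_(_ <- _) _)]mulr_sumr linear_sum big1 // => m _.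
  by rewrite -malg_scaleAr linearZ /= phi_word_rel scaler0.
rewrite (malg_word a) [_ * prel t]mulr_suml [_ * b]mulr_suml linear_sum big1 // => m _.
by rewrite -[_ * prel t]scalerAl -[_ * b]scalerAl linearZ /= phi_r scaler0.
Qed.

(** Since [phi] vanishes on the ideal, a linear relation among degree [k] products of generators
    survives replacing each product by the value of [F] on its word. *)
Lemma quadratic_pres_transfer (v : k.-tuple 'I_n -> K) (I : k.-tuple 'I_n) :
  \sum_J v J *: \prod_(a < k) pres_gen p (tnth J a) =
    \prod_(a < k) pres_gen p (tnth I a) ->
  \sum_J v J *: F J = F I.
Proof.
rewrite pres_gen_prod.
under eq_bigr => J _.
  rewrite pres_gen_prod -[_ *: _]/(pres_scale _ _) -pres_piZ; over.
rewrite -(big_morph pi (@pres_piD _ _ p) pi0) => /pres_piE /pres_idealP /phi_ideal.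
rewrite linearB linear_sum /= phi_word size_tuple eqxx => /eqP.
rewrite subr_eq0 => /eqP <-; apply: eq_bigr => J _.
by rewrite linearZ /= phi_word size_tuple eqxx.
Qed.

End QuadraticPresentation.

(** * Multi-indices and the replacement of two adjacent letters *)

Section TensorIndices.

Lemma sum_tdim (V : nmodType) (n k : nat) (G : 'I_(tdim n k) -> V) :
  \sum_i G i = \sum_(I : k.-tuple 'I_n) G (enum_rank I).
Proof. by rewrite (reindex enum_rank) //; apply/onW_bij/enum_rank_bij. Qed.

Lemma tmxE (R : Type) (n m k : nat) (f : k.-tuple 'I_n -> k.-tuple 'I_m -> R) I J :
  tmx f (enum_rank I) (enum_rank J) = f I J.
Proof. by rewrite mxE !enum_rankK. Qed.

Lemma tmxP (R : Type) (n m k : nat) (X Y : 'M[R]_(tdim n k, tdim m k)) :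
  (forall I J, X (enum_rank I) (enum_rank J) = Y (enum_rank I) (enum_rank J)) ->
  X = Y.
Proof.
by move=> XY; apply/matrixP => i j; rewrite -(enum_valK i) -(enum_valK j) XY.
Qed.

Definition subst2 (T : Type) (a : nat) (s : seq T) (i j : T) : seq T :=
  take a s ++ [:: i; j] ++ drop a.+2 s.

Lemma subst2_cat (T : Type) (u w : seq T) (x y i j : T) :
  subst2 (size u) (u ++ [:: x; y] ++ w) i j = u ++ [:: i; j] ++ w.
Proof.
by rewrite /subst2 take_size_cat // [in drop _ _]catA drop_size_cat // size_cat addn2.
Qed.

Lemma tuple_split2 (T : Type) (k : nat) (I : k.-tuple T) (a b : 'I_k) :
  b = a.+1 :> nat ->
  tval I = take a I ++ [:: tnth I a; tnth I b] ++ drop a.+2 I.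
Proof.
move=> ba; have x0 := tnth I a.
have ak : (a < size I)%N by rewrite size_tuple.
have bk : (a.+1 < size I)%N by rewrite size_tuple -ba.
rewrite !(tnth_nth x0) ba -[LHS](cat_take_drop a) (drop_nth x0) //=.
by rewrite [drop a.+1 _](drop_nth x0).
Qed.

Lemma tnth_cat2 (T : Type) (k : nat) (I : k.-tuple T) (a b : 'I_k) u x y w :
  b = a.+1 :> nat -> tval I = u ++ [:: x; y] ++ w -> size u = a ->
  tnth I a = x /\ tnth I b = y.
Proof.
move=> ba Iuw ua; rewrite !(tnth_nth x) Iuw ba -ua !nth_cat.
by rewrite ltnn subnn (ltnNge (size u).+1) leqnSn /= subSnn.
Qed.

(** The bracket keeps only the [J] that agree with [I] off [a] and [b]; such a [J] is determined by
    its two letters there, which are arbitrary. *)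
Lemma sum_subst2 (K : pzRingType) (V : lmodType K) (n k : nat) (a b : 'I_k)
    (c : 'I_n -> 'I_n -> K) (F : seq 'I_n -> V) (I : k.-tuple 'I_n) :
  b = a.+1 :> nat ->
  \sum_(J : k.-tuple 'I_n) (c (tnth J a) (tnth J b) *+
      [forall x, (x != a) && (x != b) ==> (tnth I x == tnth J x)]) *: F J =
  \sum_i \sum_j c i j *: F (subst2 a I i j).
Proof.
move=> ba.
pose h (p : 'I_n * 'I_n) := [tuple if x == a then p.1 else
                                   if x == b then p.2 else tnth I x | x < k].
have neba : b != a by rewrite -val_eqE /= ba gtn_eqF.
have hval p : tval (h p) = subst2 a I p.1 p.2.
  rewrite [LHS](tuple_split2 _ ba) /subst2 !tnth_mktuple !eqxx (negPf neba).
  have agree x : x != a -> x != b -> tnth (h p) x = tnth I x.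
    by rewrite tnth_mktuple => /negPf-> /negPf->.
  (* No bound on [x]: past the end both sides are the default [x0]. *)
  have agree_nth x0 (x : nat) : x != a -> x != a.+1 -> nth x0 (h p) x = nth x0 I x.
    have [xk nea neb|xk _ _] := ltnP x k; last by rewrite !nth_default ?size_tuple.
    by rewrite -[x]/(val (Ordinal xk)) -!(tnth_nth x0) agree // -val_eqE //= ba.
  congr (_ ++ _).
    apply: (@eq_from_nth _ p.1) => [|x]; rewrite !size_take !size_tuple // ltn_ord => xa.
    by rewrite !nth_take // agree_nth // ltn_eqF // ltnW.
  congr (_ ++ _).
  apply: (@eq_from_nth _ p.1) => [|x]; rewrite !size_drop !size_tuple // => xa.
  have ltaS : (a.+1 < a.+2 + x)%N by rewrite leq_addr.
  by rewrite !nth_drop agree_nth // gtn_eqF // ltnW.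
rewrite pair_big /=; under eq_bigr => J _ do rewrite mulrb (fun_if ( *:%R^~ (F J))) scale0r.
(* [h] and reading off the letters at [a] and [b] are mutually inverse between pairs of letters and
   the [J] allowed by the bracket. *)
rewrite -big_mkcond (reindex_onto h (fun J => (tnth J a, tnth J b))) /=.
  apply: eq_big => [p|p _]; last first.
    by rewrite hval !tnth_mktuple !eqxx (negPf neba).
  rewrite !tnth_mktuple !eqxx (negPf neba) -surjective_pairing eqxx andbT.
  by apply/forallP => x; apply/implyP => /andP[/negPf xa /negPf xb]; rewrite tnth_mktuple xa xb.
move=> J /forallP IJ; apply: eq_from_tnth => x; rewrite tnth_mktuple.
case: eqP => [->//|/eqP xa]; case: eqP => [->//|/eqP xb].
by have := IJ x; rewrite xa xb /= => /eqP.
Qed.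

End TensorIndices.

(** * Entries of products with scalar matrices *)

Section ScalarMatrices.
Variables (K : fieldType) (R : algType K).

Lemma scal_mxM (p q r : nat) (S : 'M[K]_(p, q)) (T : 'M[K]_(q, r)) :
  scal_mx R (S *m T) = scal_mx R S *m scal_mx R T.
Proof. exact: (map_mxM (in_alg R)). Qed.

Lemma scal_mxB (p q : nat) (S T : 'M[K]_(p, q)) :
  scal_mx R (S - T) = scal_mx R S - scal_mx R T.
Proof. exact: (map_mxB (in_alg R)). Qed.

Lemma scal_mx1 (p : nat) : scal_mx R (1%:M : 'M[K]_p) = 1%:M.
Proof. exact: (map_mx1 (in_alg R)). Qed.

Lemma scal_mulmxE (p q r : nat) (T : 'M[K]_(p, q)) (X : 'M[R]_(q, r)) i j :
  (scal_mx R T *m X) i j = \sum_h T i h *: X h j.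
Proof. by rewrite mxE; apply: eq_bigr => h _; rewrite mxE mulr_algl. Qed.

Lemma mulmx_scalE (p q r : nat) (X : 'M[R]_(p, q)) (T : 'M[K]_(q, r)) i j :
  (X *m scal_mx R T) i j = \sum_h T h j *: X i h.
Proof. by rewrite mxE; apply: eq_bigr => h _; rewrite mxE mulr_algr. Qed.

Lemma act_on_mulmxE (n k q : nat) (a b : 'I_k) (T : 'M[K]_(tdim n 2))
    (X : 'M[R]_(tdim n k, q)) (F : seq 'I_n -> R) (h : 'I_q) (I : k.-tuple 'I_n) :
  b = a.+1 :> nat -> (forall J : k.-tuple 'I_n, X (enum_rank J) h = F J) ->
  (scal_mx R (act_on a b T) *m X) (enum_rank I) h =
  \sum_i \sum_j coef2 T (tnth I a) (tnth I b) i j *: F (subst2 a I i j).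
Proof.
move=> ba XF; rewrite scal_mulmxE sum_tdim -(sum_subst2 _ _ _ ba).
by apply: eq_bigr => J _; rewrite tmxE XF.
Qed.

Lemma mulmx_act_onE (n k q : nat) (a b : 'I_k) (T : 'M[K]_(tdim n 2))
    (X : 'M[R]_(q, tdim n k)) (F : seq 'I_n -> R) (h : 'I_q) (I : k.-tuple 'I_n) :
  b = a.+1 :> nat -> (forall J : k.-tuple 'I_n, X h (enum_rank J) = F J) ->
  (X *m scal_mx R (act_on a b T)) h (enum_rank I) =
  \sum_i \sum_j coef2 T i j (tnth I a) (tnth I b) *: F (subst2 a I i j).
Proof.
move=> ba XF; rewrite mulmx_scalE sum_tdim.
rewrite -(sum_subst2 (fun i j => coef2 T i j (tnth I a) (tnth I b)) _ _ ba).
apply: eq_bigr => J _; rewrite tmxE XF; congr (_ *+ _ *: _).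
by congr (nat_of_bool _); apply: eq_forallb => x; rewrite [tnth _ _ == _]eq_sym.
Qed.

End ScalarMatrices.

(** * Compatibility of [act_on] with the identity and with differences *)

Section ActOn.
Variables (K : fieldType) (n k : nat) (a b : 'I_k).

Lemma coef2_1 (i j p q : 'I_n) :
  coef2 (1%:M : 'M[K]_(tdim n 2)) i j p q = ((i == p) && (j == q))%:R.
Proof.
rewrite /coef2 /tentry mxE (inj_eq enum_rank_inj) -val_eqE /=.
by rewrite !eqseq_cons andbT.
Qed.

Lemma coef2B (S T : 'M[K]_(tdim n 2)) i j p q :
  coef2 (S - T) i j p q = coef2 S i j p q - coef2 T i j p q.
Proof. by rewrite /coef2 /tentry !mxE. Qed.

Lemma act_on1 : act_on a b (1%:M : 'M[K]_(tdim n 2)) = 1%:M.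
Proof.
apply: tmxP => I J; rewrite tmxE coef2_1 !mxE (inj_eq enum_rank_inj) -mulrnA mulnb.
congr (nat_of_bool _)%:R; apply/idP/eqP => [/andP[/andP[/eqP Ia /eqP Ib] /forallP IJ]|->].
  apply: eq_from_tnth => x; have := IJ x.
  by case: (eqVneq x a) => [->//|_]; case: (eqVneq x b) => [->//|_] /eqP.
by rewrite !eqxx; apply/forallP => x; apply/implyP.
Qed.

Lemma act_onB (S T : 'M[K]_(tdim n 2)) :
  act_on a b (S - T) = act_on a b S - act_on a b T.
Proof. by apply: tmxP => I J; rewrite !mxE coef2B mulrnBl. Qed.

End ActOn.

Lemma act_on_pair (K : fieldType) (n : nat) (T : 'M[K]_(tdim n 2)) :
  act_on ord0 ord_max T = T.
Proof.
apply: tmxP => I J; rewrite tmxE /coef2 /tentry.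
have -> : [forall x : 'I_2, (x != ord0) && (x != ord_max) ==> (tnth I x == tnth J x)].
  by apply/forallP => -[[|[|]]].
have tE (L : 2.-tuple 'I_n) : [tuple tnth L ord0; tnth L ord_max] = L.
  by apply: val_inj; case: L => [[|x [|y []]]].
by rewrite !tE.
Qed.

(** * Tensor powers of Manin matrices and of products *)

Section ManinMatrices.
Variables (K : fieldType) (R : algType K).

Section MatrixPowers.
Variables (n m : nat) (M : 'M[R]_(n, m)).

Let word_entry (s : seq 'I_n) (t : seq 'I_m) : R := \prod_(p <- zip s t) M p.1 p.2.

Let mxpowE (k : nat) (I : k.-tuple 'I_n) (J : k.-tuple 'I_m) :
  mxpow k M (enum_rank I) (enum_rank J) = word_entry I J.
Proof.
rewrite tmxE /word_entry (big_tuple _ _ [tuple of zip I J] xpredT).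
apply: eq_bigr => a _; have x0 := tnth I a; have y0 := tnth J a.
by rewrite (tnth_nth (x0, y0)) nth_zip ?size_tuple //= -!tnth_nth.
Qed.

Let word_entry_subst2 (k : nat) (a b : 'I_k) (I : k.-tuple 'I_n) (J : k.-tuple 'I_m)
    i j i' j' : b = a.+1 :> nat ->
  word_entry (subst2 a I i j) (subst2 a J i' j') =
  word_entry (take a I) (take a J) * (M i i' * M j j') *
    word_entry (drop a.+2 I) (drop a.+2 J).
Proof.
move=> ba; rewrite /word_entry /subst2 zip_cat ?size_take ?size_tuple //.
by rewrite big_cat /= !big_cons /= !mulrA.
Qed.

(** The operators touch only positions [a] and [b], so the factors to the left and to the right of
    these come out of the sums, in their original order since [R] need not be commutative. *)
Let act_on_mxpowE (A : 'M[K]_(tdim n 2)) (B : 'M[K]_(tdim m 2)) (k : nat) (a b : 'I_k) (I : k.-tuple 'I_n) (J : k.-tuple 'I_m) :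
  b = a.+1 :> nat ->
  (scal_mx R (act_on a b A) *m mxpow k M *m scal_mx R (act_on a b B))
    (enum_rank I) (enum_rank J) =
  word_entry (take a I) (take a J) *
  (\sum_i \sum_j coef2 A (tnth I a) (tnth I b) i j *:
   \sum_i' \sum_j' coef2 B i' j' (tnth J a) (tnth J b) *: (M i i' * M j j')) *
  word_entry (drop a.+2 I) (drop a.+2 J).
Proof.
move=> ba; rewrite -mulmxA (act_on_mulmxE
  (F := fun s => \sum_i' \sum_j' coef2 B i' j' (tnth J a) (tnth J b) *:
                    word_entry s (subst2 a J i' j')) _ _ ba) => [|I'].
  rewrite mulr_sumr mulr_suml; apply: eq_bigr => i _.
  rewrite mulr_sumr mulr_suml; apply: eq_bigr => j _.
  rewrite -scalerAr -scalerAl; congr (_ *: _).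
  rewrite mulr_sumr mulr_suml; apply: eq_bigr => i' _.
  rewrite mulr_sumr mulr_suml; apply: eq_bigr => j' _.
  by rewrite -scalerAr -scalerAl (word_entry_subst2 _ _ _ _ _ _ ba).
by rewrite (mulmx_act_onE (F := word_entry I') _ _ ba) // => J'; rewrite mxpowE.
Qed.

(** The middle factor in [act_on_mxpowE] depends only on the letters of [I] and [J] at [a] and [b].
    For [k = 2] the outer words are empty, so this factor is an entry of the Manin relation, hence 0
    for every [k]. *)
Lemma manin_act_on (A : 'M[K]_(tdim n 2)) (B : 'M[K]_(tdim m 2)) (k : nat) (a b : 'I_k) :
  b = a.+1 :> nat -> manin A B M ->
  scal_mx R (act_on a b A) *m mxpow k M *m scal_mx R (act_on a b (1%:M - B)) = 0.
Proof.
rewrite /manin => ba maninM; apply: tmxP => I J; rewrite act_on_mxpowE // mxE.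
pose I2 := [tuple tnth I a; tnth I b]; pose J2 := [tuple tnth J a; tnth J b].
have := @act_on_mxpowE A (1%:M - B) 2 ord0 ord_max I2 J2 erefl.
rewrite !act_on_pair maninM mxE /word_entry /= !big_nil mul1r mulr1.
by move=> <-; rewrite mulr0 mul0r.
Qed.

End MatrixPowers.

Lemma prodr_mul_comm (k : nat) (x y : 'I_k -> R) :
  (forall a b, GRing.comm (x a) (y b)) ->
  \prod_(a < k) (x a * y a) = (\prod_(a < k) x a) * (\prod_(a < k) y a).
Proof.
elim: k x y => [|k IH] x y xy; first by rewrite !big_ord0 mulr1.
rewrite !big_ord_recl IH => [|a b]; last exact: xy.
rewrite !mulrA; congr (_ * _); rewrite -!mulrA; congr (_ * _).
by apply: commr_prod => a _; apply: commr_sym; apply: xy.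
Qed.

Lemma mxpow_mul (n m l k : nat) (M : 'M[R]_(n, m)) (N : 'M[R]_(m, l)) :
  (forall i j i' j', M i j * N i' j' = N i' j' * M i j) ->
  mxpow k (M *m N) = mxpow k M *m mxpow k N.
Proof.
move=> commMN; apply: tmxP => I J; rewrite tmxE mxE sum_tdim.
under eq_bigr => a _ do rewrite mxE.
(* Distributivity yields a sum over functions from ['I_k] to ['I_m], identified with the
   intermediate multi-indices [L]. *)
rewrite bigA_distr_bigA (reindex (@finfun_of_tuple _ _)) /=; last first.
  exact/onW_bij/(Bijective finfun_of_tupleK tuple_of_finfunK).
apply: eq_bigr => L _; rewrite !tmxE.
under eq_bigr => a _ do rewrite ffunE.
by rewrite prodr_mul_comm // => a b; apply: commMN.
Qed.

End ManinMatrices.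

(** * Matrices fixed by a pairing operator *)

Section PairingAbsorption.
Variables (K : fieldType) (R : algType K) (n k : nat) (A : 'M[K]_(tdim n 2)).

(** Supplies the function on sequences that [quadratic_pres_transfer] expects; only words of length
    [k] matter, so the default 0 is harmless. *)
Let extend (f : k.-tuple 'I_n -> R) (s : seq 'I_n) : R := oapp f 0 (insub s).

Let extendE f (J : k.-tuple 'I_n) : extend f J = f J.
Proof. by rewrite /extend valK. Qed.

Let positions (u w : seq 'I_n) (x y : 'I_n) : (size u + 2 + size w)%N = k ->
  exists (a b : 'I_k) (I : k.-tuple 'I_n), [/\ b = a.+1 :> nat,
    tnth I a = x, tnth I b = y &
    forall i j, subst2 a I i j = u ++ [:: i; j] ++ w].
Proof.
move=> uwk; have ltb : ((size u).+1 < k)%N by rewrite -uwk addn2 leq_addr.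
have sizeI : size (u ++ [:: x; y] ++ w) == k by rewrite !size_cat addnA uwk.
pose I : k.-tuple 'I_n := Tuple sizeI.
have [Ia Ib] := @tnth_cat2 _ k I (Ordinal (ltnW ltb)) (Ordinal ltb) u x y w erefl erefl erefl.
by do 3 eexists; split; [|exact: Ia|exact: Ib|exact: subst2_cat].
Qed.

(** The leading monomial is the contribution of the identity matrix, so the relations of Xi_A are
    the columns of [1 - A]. *)
Let Xi_relE (kl : 'I_n * 'I_n) : Xi_rel A kl =
  \sum_i \sum_j coef2 (1%:M - A) i j kl.1 kl.2 *: (@free_gen K n i * @free_gen K n j).
Proof.
rewrite /Xi_rel; under [RHS]eq_bigr => i _.
  under eq_bigr => j _ do rewrite coef2B scalerBl coef2_1.
  rewrite big_split sumrN /=; over.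
rewrite big_split sumrN /=; congr (_ - _); rewrite pair_big /=.
rewrite (bigD1 kl) //= !eqxx scale1r big1 ?addr0 // => p /negPf.
by case: p kl => [i j] [i' j']; rewrite xpair_eqE /= => ->; rewrite scale0r.
Qed.

(** For a fixed column [h], row [J] of the vanishing product is the relation of X_A indexed by the
    letters of [J] at [a] and [b], placed between the remaining letters. Row [I] of [SX] is then
    transferred to [Q]. *)
Lemma X_absorb (S : 'M[K]_(tdim n k)) (q : nat) (Q : 'M[R]_(tdim n k, q)) :
  scal_mx (pres_alg (X_pres A)) S *m colpow k (@X_gen _ _ A) = colpow k (@X_gen _ _ A) ->
  (forall a b : 'I_k, b = a.+1 :> nat -> scal_mx R (act_on a b A) *m Q = 0) ->
  scal_mx R S *m Q = Q.
Proof.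
move=> SX AQ; apply/matrixP => i h; rewrite -(enum_valK i); set I := enum_val i.
rewrite scal_mulmxE sum_tdim; pose F := extend (fun J => Q (enum_rank J) h).
have FE J : Q (enum_rank J) h = F J by rewrite /F extendE.
under eq_bigr => J _ do rewrite FE.
rewrite FE; apply: (@quadratic_pres_transfer K n (X_pres A)
  (fun kl i j => coef2 A kl.1 kl.2 i j)) => // [[x y] u w uwk|].
  have [a [b [J [ba <- <- uw]]]] := positions x y uwk.
  have := @act_on_mulmxE K R n k q a b A Q F h J ba FE.
  rewrite AQ // mxE => /esym; apply: etrans.
  by apply: eq_bigr => i0 _; apply: eq_bigr => j0 _; rewrite uw.
have := congr1 (fun Z : 'cV__ => Z (enum_rank I) 0) SX.
rewrite scal_mulmxE sum_tdim mxE enum_rankK => <-.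
by apply: eq_bigr => J _; rewrite mxE enum_rankK.
Qed.

(** Transposed form of [X_absorb]: the argument runs along a row of [Q], with the relations of Xi_A
    in the form [Xi_relE]. *)
Lemma Xi_absorb (S : 'M[K]_(tdim n k)) (q : nat) (Q : 'M[R]_(q, tdim n k)) :
  rowpow k (@Xi_gen _ _ A) *m scal_mx (pres_alg (Xi_pres A)) S = rowpow k (@Xi_gen _ _ A) ->
  (forall a b : 'I_k, b = a.+1 :> nat -> Q *m scal_mx R (act_on a b (1%:M - A)) = 0) ->
  Q *m scal_mx R S = Q.
Proof.
move=> SX AQ; apply/matrixP => h i; rewrite -(enum_valK i); set I := enum_val i.
rewrite mulmx_scalE sum_tdim; pose F := extend (fun J => Q h (enum_rank J)).
have FE J : Q h (enum_rank J) = F J by rewrite /F extendE.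
under eq_bigr => J _ do rewrite FE.
rewrite FE; apply: (@quadratic_pres_transfer K n (Xi_pres A)
  (fun kl i j => coef2 (1%:M - A) i j kl.1 kl.2)) => // [[x y] u w uwk|].
  have [a [b [J [ba <- <- uw]]]] := positions x y uwk.
  have := @mulmx_act_onE K R n k q a b (1%:M - A) Q F h J ba FE.
  rewrite AQ // mxE => /esym; apply: etrans.
  by apply: eq_bigr => i0 _; apply: eq_bigr => j0 _; rewrite uw.
have := congr1 (fun Z : 'rV__ => Z 0 (enum_rank I)) SX.
rewrite mulmx_scalE sum_tdim mxE enum_rankK => <-.
by apply: eq_bigr => J _; rewrite mxE enum_rankK.
Qed.

End PairingAbsorption.

(** * Absorption of pairing operators by minors of a Manin matrix *)

Section MinorAbsorption.
Variables (K : fieldType) (R : algType K) (n m k : nat) (M : 'M[R]_(n, m)).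
Variables (A : 'M[K]_(tdim n 2)) (B : 'M[K]_(tdim m 2)).
Hypothesis maninM : manin A B M.

Lemma S_pairing_minor_lower (S : 'M[K]_(tdim n k)) (S' : 'M[K]_(tdim m k)) :
  S_pairing A S -> S_pairing B S' ->
  scal_mx R S *m minor_lower S' M = minor_lower S' M.
Proof.
case=> _ _ SX [BS' _ _]; apply: (X_absorb SX) => a b ba.
(* [B^(a,a+1) S' = 0] allows inserting [(1 - B)^(a,a+1)] before [S'], which completes the Manin
   relation at positions [a] and [b]. *)
have -> : S' = act_on a b (1%:M - B) *m S'.
  by have [BS0 _] := BS' a b ba; rewrite act_onB act_on1 mulmxBl mul1mx BS0 subr0.
by rewrite /minor_lower scal_mxM !mulmxA manin_act_on // mul0mx.
Qed.

Lemma A_pairing_minor_upper (S : 'M[K]_(tdim n k)) (S' : 'M[K]_(tdim m k)) :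
  A_pairing A S -> A_pairing B S' ->
  minor_upper S M *m scal_mx R S' = minor_upper S M.
Proof.
case=> AS _ _ [_ SX _]; apply: (Xi_absorb SX) => a b ba.
(* Dually, [S (1 - A)^(a,a+1) = 0] gives [S = S A^(a,a+1)], the left half of the Manin relation. *)
have [_ /eqP] := AS a b ba.
rewrite act_onB act_on1 mulmxBr mulmx1 subr_eq0 /minor_upper => /eqP ->.
by rewrite scal_mxM -!mulmxA [_ *m (mxpow k M *m _)]mulmxA manin_act_on // mulmx0.
Qed.

End MinorAbsorption.

Theorem proposition5p19 (R : realType) (n m l k : nat)
  (A : 'M[R[i]]_(tdim n 2)) (tA : 'M[R[i]]_(tdim m 2)) (hA : 'M[R[i]]_(tdim l 2))
  (Sk Ak : 'M[R[i]]_(tdim n k)) (tSk tAk : 'M[R[i]]_(tdim m k))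
  (hSk hAk : 'M[R[i]]_(tdim l k))
  (idA : idempotent_mx A) (idtA : idempotent_mx tA) (idhA : idempotent_mx hA)
  (pairA : pairing_operators A Sk Ak)
  (pairtA : pairing_operators tA tSk tAk)
  (pairhA : pairing_operators hA hSk hAk)
  (RR : algType R[i]) (M : 'M[RR]_(n, m)) (N : 'M[RR]_(m, l))
  (commMN : forall i j i' j', M i j * N i' j' = N i' j' * M i j) :
  [/\ manin tA hA N ->
        minor Sk hSk (M *m N) = minor Sk tSk M *m minor_lower hSk N,
      manin A tA M ->
        minor Ak hAk (M *m N) = minor_upper Ak M *m minor tAk hAk N
    & manin A tA M -> manin tA hA N ->
        [/\ manin A hA (M *m N),
            minor_lower hSk (M *m N) = minor_lower tSk M *m minor_lower hSk N
          & minor_upper Ak (M *m N) = minor_upper Ak M *m minor_upper tAk N]].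
Proof.
case: pairA pairtA pairhA => [SA AA] [StA AtA] [ShA AhA].
have MNpow k' : mxpow k' (M *m N) = mxpow k' M *m mxpow k' N by exact: mxpow_mul.
split.
(* On the right-hand side [tSk] stands directly before [N^(k) hSk], which absorbs it. *)
- move=> maninN; have := S_pairing_minor_lower maninN StA ShA.
  by rewrite /minor /minor_lower MNpow -!mulmxA => ->.
(* Here [tAk] stands directly after [Ak M^(k)], which absorbs it. *)
- move=> maninM; have := A_pairing_minor_upper maninM AA AtA.
  by rewrite /minor /minor_upper MNpow !mulmxA => ->.
move=> maninM maninN; split.
- move: maninM maninN; rewrite /manin MNpow !scal_mxB !scal_mx1 => maninM maninN.
  (* The relation for [M] lets [tA] be inserted after [A M^(1) M^(2)]; the relation for [N] then
     gives 0. *)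
  have -> : scal_mx RR A *m (mxpow 2 M *m mxpow 2 N) =
      scal_mx RR A *m mxpow 2 M *m scal_mx RR tA *m mxpow 2 N.
    apply/eqP; move/eqP: maninM; rewrite mulmxBr mulmx1 subr_eq0 mulmxA => /eqP maninM.
    by rewrite -maninM.
  by rewrite -!mulmxA [scal_mx RR tA *m _]mulmxA maninN !mulmx0.
- have := S_pairing_minor_lower maninN StA ShA.
  by rewrite /minor_lower MNpow -!mulmxA => ->.
- have := A_pairing_minor_upper maninM AA AtA.
  by rewrite /minor_upper MNpow !mulmxA => ->.
Qed.
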